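(* Let $\psi$ be a 2CSP instance on $n$ variables with constant-size alphabet $A$ whose constraint graph is $d$-regular for a constant $d$, and suppose $\mathrm{OPT}(\psi)<1-\eta$ for a constant $\eta>0$. Let $G_\psi=(V,E)$ be the graph constructed below, with $\rho=\sqrt{n}\log\log n$ and $k=\binom{n}{\rho}$. Then there are constants $\epsilon_0>0$ and $\delta>0$ (depending only on $\eta$, $|A|$, $d$) such that, for $n$ sufficiently large, every $S\subseteq V$ of size $k' = k\cdot |V|^{-\epsilon_0/\log\log|V|}$ satisfies $\mathrm{den}(S)<1-\delta$.
   Context: A 2CSP instance $\psi$ consists of a constraint graph on variables $x_1,\dots,x_n$, each edge $(x_i,x_j)$ carrying a constraint $\psi_{i,j}:A\times A\to\{0,1\}$ specifying allowed pairs of labels; $\mathrm{OPT}(\psi)$ is the maximum over assignments $[n]\to A$ of the fraction of satisfied constraints. Construction of $G_\psi$: set $\rho=\sqrt n\log\log n$ and $k=\binom n\rho$. The vertices are all pairs $v=(T,y)$ where $T\subseteq[n]$ is a set of $\rho$ variables and $y:T\to A$ is an assignment to them (so $|V|=\binom n\rho|A|^\rho$). A vertex $v=(T,y)$ violates a 2CSP constraint if some constraint on $(x_i,x_j)$ with $i,j\in T$ is not satisfied by $(y(i),y(j))$; such vertices are isolated. For non-isolated $u=(T,y)$, $v=(T',y')$, the ordered pair $(u,v)$ is in $E$ iff (i) for every shared variable $i\in T\cap T'$, $y(i)=y'(i)$, and (ii) for every constraint on $(x_i,x_j)$ with $i\in T$, $j\in T'$, the pair $(y(i),y'(j))$ satisfies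 it. Density: $\mathrm{den}(S)=\frac{|(S\times S)\cap E|}{|S\times S|}$. Logarithms are base 2. *)

(* Defs.v *)
From HB Require Import structures.
From mathcomp Require Import all_boot all_order all_algebra.
From mathcomp Require Import reals exp.
Set Implicit Arguments. Unset Strict Implicit. Unset Printing Implicit Defensive.
Import Order.TTheory GRing.Theory Num.Theory.
Local Open Scope ring_scope.

(* A 2CSP instance on variables 'I_n with alphabet A:
   cadj is the (simple, undirected) constraint graph, and
   cons i j a b says whether the pair of labels (a,b) for (x_i,x_j) is allowed. *)
Record csp2 (n : nat) (A : finType) := CSP2 {
  cadj : rel 'I_n;
  cons : 'I_n -> 'I_n -> A -> A -> bool }.

Definition csp2_wf (n : nat) (A : finType) (psi : csp2 n A) : Prop :=
  [/\ forall i j, cadj psi i j = cadj psi j i,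
      forall i, ~~ cadj psi i i &
      forall i j a b, cadj psi i j -> cons psi i j a b = cons psi j i b a].

Definition csp2_regular (n : nat) (A : finType) (psi : csp2 n A) (d : nat) : Prop :=
  forall i : 'I_n, #|[set j | cadj psi i j]| = d.

(* fraction of constraints satisfied by sigma; each undirected constraint is
   counted once in each orientation in numerator and denominator alike. *)
Definition csp2_val (R : realType) (n : nat) (A : finType) (psi : csp2 n A) (sigma : {ffun 'I_n -> A}) : R :=
  (#|[set p : 'I_n * 'I_n | cadj psi p.1 p.2 && cons psi p.1 p.2 (sigma p.1) (sigma p.2)]|%:R)
  / (#|[set p : 'I_n * 'I_n | cadj psi p.1 p.2]|%:R).

Definition OPT (R : realType) (n : nat) (A : finType) (psi : csp2 n A) : R :=
  \big[Num.max/0]_(sigma : {ffun 'I_n -> A}) csp2_val R psi sigma.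

Definition log2 (R : realType) (x : R) : R := ln x / ln 2.

Definition rho_of (R : realType) (n : nat) : nat :=
  Num.truncn (Num.sqrt (n%:R : R) * log2 (log2 (n%:R : R))).

(* A vertex (T, y) with |T| = rho, y : T -> A is encoded as a partial assignment
   y : 'I_n -> option A with domain T = [set i | y i != None]. *)
Definition vdom (n : nat) (A : finType) (y : {ffun 'I_n -> option A}) : {set 'I_n} :=
  [set i | y i != None].

Definition Vset (n : nat) (A : finType) (rho : nat) : {set {ffun 'I_n -> option A}} :=
  [set y | #|vdom y| == rho].

Definition violates (n : nat) (A : finType) (psi : csp2 n A) (y : {ffun 'I_n -> option A}) : bool :=
  [exists i, exists j, exists a, exists b,
     [&& cadj psi i j, y i == Some a, y j == Some b & ~~ cons psi i j a b]].

Definition Gedge (n : nat) (A : finType) (psi : csp2 n A) (u v : {ffun 'I_n -> option A}) : bool :=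
  [&& ~~ violates psi u, ~~ violates psi v,
      [forall i, [forall a, [forall b,
          (u i == Some a) && (v i == Some b) ==> (a == b)]]] &
      [forall i, [forall j, [forall a, [forall b,
          [&& cadj psi i j, u i == Some a & v j == Some b] ==> cons psi i j a b]]]]].

Definition den (R : realType) (n : nat) (A : finType) (psi : csp2 n A) (S : {set {ffun 'I_n -> option A}}) : R :=
  #|[set p in setX S S | Gedge psi p.1 p.2]|%:R / (#|S|%:R ^+ 2).

(* Main.v *)
Require Import Defs.
From HB Require Import structures.
From mathcomp Require Import all_boot all_order all_algebra.
From mathcomp Require Import reals sequences exp.
From mathcomp Require Import zify ring lra.
Import Order.TTheory GRing.Theory Num.Theory.
Local Open Scope ring_scope.
Set Implicit Arguments.
Unset Strict Implicit.
Unset Printing Implicit Defensive.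

(** For large [n] the size of [S] is at least ['C(n, rho)] up to a factor
    exponential in a small multiple of [rho].  Suppose [S] is almost a clique.
    Among the vertices of [S] with few non-neighbours, choose a maximal family [C]
    whose variable sets cover at least [t ~ c rho] variables per member; then [C]
    has at most [n / t = o(rho)] members, and every remaining well-connected vertex
    has fewer than [t] variables outside the union [U] of [C].  By pigeonhole over
    the [2 ^ o(rho)] subfamilies of [C], a large part [S1] of [S] is completely
    joined to one [I] containing almost all of [C].  A vertex of [S1] may only use
    labels compatible with all of [I]: at most one label on each variable covered
    by [I].  Weighting the compatible labels by [1] on [U] and by [1 / (2 |A|)] off
    [U], with total weight [W], gives [#|S1| <= (2 |A|) ^ (t - 1) W ^ rho / rho!].
    As [S1] is large, [W] is nearly [n], so almost every variable is covered by [I]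
    and has exactly one compatible label; these labels satisfy every constraint
    between such variables, which contradicts [OPT < 1 - eta]. *)

(** * Weighted counting of sets of fixed size *)

(** Expanding the power as a sum over [r]-tuples, each [r]-subset occurs once for each of its [r!]
    orderings, and all other tuples contribute nonnegative terms. The induction removes one marked
    element at a time. *)
Lemma sum_prod_subsets_le (R : realFieldType) (X : finType) (f : X -> R) (r : nat) :
  (forall x, 0 <= f x) ->
  (\sum_(P : {set X} | #|P| == r) \prod_(x in P) f x) * (r`!)%:R
    <= (\sum_x f x) ^+ r.
Proof.
move=> f0; elim: r => [|r IH].
  rewrite fact0 mulr1 expr0 (eq_bigl (pred1 set0)) => [|P]; last first.
    by rewrite /= cards_eq0.
  by rewrite big_pred1_eq big_set0.
have W0 : 0 <= \sum_x f x by apply: sumr_ge0.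
rewrite factS natrM mulrA exprS.
apply: (@le_trans _ _ ((\sum_x f x) * ((\sum_(P : {set X} | #|P| == r)
    \prod_(x in P) f x) * (r`!)%:R))); last exact: ler_wpM2l.
rewrite [leRHS]mulrA; apply: ler_wpM2r; first exact: ler0n.
(* Double counting of pairs [x \in P]: each set of size [r.+1] has [r.+1] marked elements. *)
have -> : (\sum_(P : {set X} | #|P| == r.+1) \prod_(x in P) f x) * r.+1%:R
  = \sum_x \sum_(P : {set X} | (x \in P) && (#|P| == r.+1)) \prod_(y in P) f y.
  rewrite mulr_suml (exchange_big_dep (fun P : {set X} => #|P| == r.+1)) /=;
    last by move=> x P _ /andP[].
  apply: eq_bigr => P /eqP cP; rewrite -cP.
  rewrite [RHS](eq_bigl (fun x => x \in P)) => [|x]; last by rewrite eqxx andbT.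
  by rewrite sumr_const mulr_natr.
rewrite mulr_suml; apply: ler_sum => x _.
rewrite (reindex_onto (fun P => x |: P) (fun P => P :\ x)) /=; last first.
  by move=> P /andP[xP _]; rewrite setD1K.
rewrite mulr_sumr big_mkcond [leRHS]big_mkcond /=; apply: ler_sum => P _.
have p0 : 0 <= \prod_(y in P) f y by apply: prodr_ge0.
case: ifP => [/andP[/andP[_ c1] /eqP e1]|_]; last first.
  by case: ifP => // _; apply: mulr_ge0.
have xP : x \notin P by rewrite -e1 setD11.
rewrite cardsU1 xP eqSS in c1; rewrite c1.
by rewrite big_setU1.
Qed.

Lemma weighted_card_le (R : realFieldType) (X : finType) (f : X -> R) (r : nat)
    (F : {set {set X}}) (c : R) :
  (forall x, 0 <= f x) ->
  (forall P, P \in F -> #|P| = r /\ c <= \prod_(x in P) f x) ->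
  #|F|%:R * c * (r`!)%:R <= (\sum_x f x) ^+ r.
Proof.
move=> f0 HF; apply: le_trans (@sum_prod_subsets_le _ _ _ r f0).
apply: ler_wpM2r; first exact: ler0n.
rewrite mulrC mulr_natr -sumr_const big_mkcond [leRHS]big_mkcond /=.
apply: ler_sum => P _; case: ifP => [/HF[-> le]|_]; first by rewrite eqxx.
by case: ifP => // _; apply: prodr_ge0.
Qed.

(** * A completely joined piece of an almost complete set *)

Lemma markov_card (T : finType) (S : {set T}) (g : T -> nat) (a : nat) :
  (#|[set x in S | (a < g x)%N]| * a <= \sum_(x in S) g x)%N.
Proof.
rewrite -sum_nat_const big_mkcond [X in (_ <= X)%N]big_mkcond /=.
by apply: leq_sum => x _; rewrite inE; case: (x \in S) => //=; case: ltnP => // /ltnW.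
Qed.

Lemma sum_card_sym (T : finType) (e : rel T) (A B : {set T}) :
  (\sum_(x in A) #|[set y in B | e x y]| = \sum_(y in B) #|[set x in A | e x y]|)%N.
Proof.
transitivity (\sum_(x in A) \sum_(y in B | e x y) 1)%N.
  by apply: eq_bigr => x _; rewrite sum1dep_card; apply: eq_card => y; rewrite !inE.
rewrite (exchange_big_dep (mem B)) /=; last by move=> x y _ /andP[].
apply: eq_bigr => y yB; rewrite sum1dep_card; apply: eq_card => x.
by rewrite !inE yB.
Qed.

(** [C] is a maximal family of well-connected vertices each paying for [t] covered points, and [S1]
    is a most popular fiber of the map sending a vertex to its neighbours in [C]. The two Markov
    steps discard at most 1/4 and 1/2 of [S], which leaves the factor 4. *)
Lemma dense_set_fiber (T J : finType) (e : rel T) (S : {set T}) (dom : T -> {set J})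
    (q t : nat) :
  (0 < q)%N -> (0 < t)%N -> S != set0 ->
  (8 * q ^ 2 * #|[set p in setX S S | ~~ e p.1 p.2]| <= #|S| ^ 2)%N ->
  exists C I S1 : {set T},
    [/\ I \subset C, C \subset S & S1 \subset S] /\
    [/\ (#|C| * t <= #|\bigcup_(c in C) dom c|)%N,
        (q * #|C :\: I| <= #|C|)%N,
        (#|S| <= 4 * (2 ^ #|C| * #|S1|))%N,
        forall u c, u \in S1 -> c \in I -> e u c &
        forall u, u \in S1 -> (#|dom u :\: \bigcup_(c in C) dom c| < t)%N].
Proof.
move=> q0 t0 S0 HN.
have s0 : (0 < #|S|)%N by rewrite card_gt0.
pose na c := #|[set u in S | ~~ e u c]|.
have HNs : (\sum_(c in S) na c = #|[set p in setX S S | ~~ e p.1 p.2]|)%N.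
  rewrite -(@sum_card_sym _ (fun x y => ~~ e x y) S S) -sum1dep_card.
  rewrite (eq_bigl (fun p : T * T => (p.1 \in S) && ((p.2 \in S) && ~~ e p.1 p.2))); last first.
    by move=> p; rewrite !inE andbA.
  rewrite -(@pair_big_dep _ _ _ _ _ (mem S) (fun i j => (j \in S) && ~~ e i j) (fun _ _ => 1%N)) /=.
  by apply: eq_bigr => x _; rewrite sum1dep_card.
(* With at most [#|S| / (2 q)] non-neighbours for each [c], Markov's inequality later leaves at most
   half of [S] missing more than [#|C| / q] members of any family [C] inside [S']. *)
pose S' := [set c in S | (2 * q * na c <= #|S|)%N].
have bad1 : (4 * #|S :\: S'| <= #|S|)%N.
  have := @markov_card _ S (fun c => 2 * q * na c)%N #|S|.
  rewrite -big_distrr /= HNs.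
  have -> : [set x in S | (#|S| < 2 * q * na x)%N] = S :\: S'.
    by apply/setP=> x; rewrite !inE ltnNge; case: (x \in S); rewrite ?andbT ?andbF.
  by set b := #|_ :\: _|; set N := #|[set p in _ | _]| in HN *; nia.
pose P (C : {set T}) := (C \subset S') && (#|C| * t <= #|\bigcup_(c in C) dom c|)%N.
have P0 : P set0 by rewrite /P sub0set cards0.
(* Maximality: a vertex of [S'] with [t] or more uncovered elements could be added to [C]. *)
have [C /maxsetP[/andP[CS' Ct] Cmax] _] := maxset_exists P0.
have stuck u : u \in S' -> (#|dom u :\: \bigcup_(c in C) dom c| < t)%N.
  move=> uS'; rewrite ltnNge; apply/negP => tle.
  have uC : u \notin C.
    apply/negP => uC; move: tle; suff -> : dom u :\: \bigcup_(c in C) dom c = set0.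
      by rewrite cards0 leqNgt t0.
    by apply/eqP; rewrite setD_eq0; apply: bigcup_sup.
  have /Cmax : P (u |: C).
    rewrite /P subUset sub1set uS' CS' /= cardsU1 uC big_setU1 //=.
    move: tle Ct.
    have -> : dom u :|: \bigcup_(i in C) dom i =
        (\bigcup_(i in C) dom i) :|: (dom u :\: \bigcup_(i in C) dom i).
      by apply/setP=> x; rewrite !inE; case: (x \in \bigcup_(i in C) dom i);
        rewrite ?orbT ?orbF ?andbT.
    rewrite cardsU.
    have -> : (\bigcup_(i in C) dom i) :&: (dom u :\: \bigcup_(i in C) dom i) = set0.
      by apply/setP=> x; rewrite !inE; case: (x \in \bigcup_(i in C) dom i).
    by rewrite cards0; lia.
  by move=> /(_ (subsetUr _ _)) /setP /(_ u); rewrite setU11 (negbTE uC).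
have CS : C \subset S by apply: subset_trans CS' _; apply/subsetP=> x; rewrite inE => /andP[].
pose I_ u := [set c in C | e u c].
pose nb u := #|[set c in C | ~~ e u c]|.
pose S2 := [set u in S' | (q * nb u <= #|C|)%N].
have bad2 : (2 * #|[set u in S | (#|C| < q * nb u)%N]| <= #|S|)%N.
  (* Markov's inequality requires cancelling [#|C|], so an empty [C] is treated apart. *)
  have [C0|C0] := posnP #|C|.
    rewrite (_ : [set _ in S | _] = set0) ?cards0 //.
    apply/setP => u; rewrite !inE C0 /nb.
    suff -> : [set c in C | ~~ e u c] = set0 by rewrite cards0 muln0 andbF.
    by move/cards0_eq: C0 => ->; apply/setP => x; rewrite !inE.
  have := @markov_card _ S (fun u => q * nb u)%N #|C|.
  rewrite -big_distrr /= /nb (@sum_card_sym _ (fun x y => ~~ e x y)).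
  have : (\sum_(y in C) 2 * q * na y <= \sum_(y in C) #|S|)%N.
    by apply: leq_sum => c /(subsetP CS'); rewrite inE => /andP[].
  rewrite -big_distrr /= sum_nat_const /na; move: C0.
  by set b := #|[set u in S | _]|; set w := (\sum_(y in C) _)%N; nia.
have S2S : (#|S| <= 4 * #|S2|)%N.
  have : (#|S| <= #|S2| + #|S :\: S'| + #|[set u in S | (#|C| < q * nb u)%N]|)%N.
    have sub : S \subset S2 :|: (S :\: S') :|: [set u in S | (#|C| < q * nb u)%N].
      apply/subsetP=> u uS; rewrite !inE uS /= ltnNge.
      by case: (_ <= _)%N => //=; case: (_ <= _)%N.
    apply: leq_trans (subset_leq_card sub) _.
    apply: leq_trans (leq_card_setU _ _) _; rewrite leq_add2r.
    exact: leq_card_setU.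
  by move: bad1 bad2; lia.
have S20 : (0 < #|S2|)%N by lia.
(* Pigeonhole over the [2 ^ #|C|] subsets of [C]: if every fiber were too small, summing over all
   subsets would give [#|S2| < #|S2|]. *)
have : exists2 I : {set T}, I \subset C & (#|S2| <= 2 ^ #|C| * #|[set u in S2 | I_ u == I]|)%N.
  apply/exists_inP; apply/contraT => /exists_inPn H.
  have : (\sum_(I in powerset C) 2 ^ #|C| * #|[set u in S2 | I_ u == I]| <
          \sum_(I in powerset C) #|S2|)%N.
    rewrite [X in (X < _)%N](bigD1 set0) ?powersetE ?sub0set //=.
    rewrite [X in (_ < X)%N](bigD1 set0) ?powersetE ?sub0set //=.
    rewrite -addSn; apply: leq_add; first by have := H set0 (sub0set _); rewrite -ltnNge.
    apply: leq_sum => I /andP[]; rewrite powersetE => /H.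
    by rewrite -ltnNge => /ltnW.
  rewrite sum_nat_const card_powerset -big_distrr /= ltn_pmul2l ?expn_gt0 //.
  suff -> : (\sum_(I in powerset C) #|[set u in S2 | I_ u == I]| = #|S2|)%N by rewrite ltnn.
  rewrite -[RHS]sum1_card (partition_big I_ (mem (powerset C))) /=; last first.
    by move=> u _; rewrite powersetE; apply/subsetP=> c; rewrite inE => /andP[].
  by apply: eq_bigr => I _; rewrite sum1dep_card.
case=> I IC HI; exists C, I, [set u in S2 | I_ u == I]; split; first split=> //.
  by apply/subsetP=> u; rewrite !inE => /andP[/andP[/andP[]]].
split=> //.
(* The chosen fiber is nonempty, and any [u] in it has [I_ u = I], so [C :\: I] consists of the few
   non-neighbours of [u] in [C]. *)
- have : (0 < #|[set u in S2 | I_ u == I]|)%N.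
    by rewrite lt0n; apply/eqP => z; rewrite z muln0 in HI; lia.
  case/card_gt0P=> u; rewrite !inE => /andP[/andP[_ H] /eqP <-].
  apply: leq_trans H; rewrite leq_mul2l; apply/orP; right.
  apply: subset_leq_card; apply/subsetP=> c; rewrite !inE.
  by case: (c \in C) => //=; case: (e u c).
- by move: S2S HI; set a := (2 ^ _ * _)%N; lia.
- by move=> u c; rewrite inE => /andP[_ /eqP <-]; rewrite inE => /andP[].
by move=> u; rewrite !inE -!andbA => /and3P[uS c1 _]; apply: stuck; rewrite inE uS c1.
Qed.

(** * Partial assignments as sets of pairs *)

(** This form makes vertices sets of size [rho], to which the weighted count applies. *)
Definition graph_of (n : nat) (A : finType) (u : {ffun 'I_n -> option A}) :
  {set 'I_n * A} := [set p | u p.1 == Some p.2].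

Lemma graph_of_inj (n : nat) (A : finType) : injective (@graph_of n A).
Proof.
move=> u v /setP uv; apply/ffunP => i.
have H a : (u i == Some a) = (v i == Some a) by have := uv (i, a); rewrite !inE.
case ui : (u i) => [a|]; first by have := H a; rewrite ui eqxx => /esym/eqP ->.
by case vi : (v i) => [a|] //; have := H a; rewrite ui vi eqxx.
Qed.

Lemma card_graph_of_dom (n : nat) (A : finType) (u : {ffun 'I_n -> option A})
    (B : {set 'I_n}) :
  #|[set p in graph_of u | p.1 \in B]| = #|vdom u :&: B|.
Proof.
have -> : vdom u :&: B = [set p.1 | p in [set p in graph_of u | p.1 \in B]].
  apply/setP=> i; rewrite !inE; apply/andP/imsetP => [[]|[[j a]]].
    by case ui: (u i) => [a|] // _ iB; exists (i, a); rewrite // !inE /= ui eqxx.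
  by rewrite !inE /= => /andP[/eqP ui iB] ->; rewrite ui.
rewrite card_in_imset // => -[i a] [j b]; rewrite !inE /=.
by move=> /andP[/eqP ui _] /andP[/eqP uj _] ij; move: uj; rewrite -ij ui => -[->].
Qed.

Lemma card_graph_of (n : nat) (A : finType) (u : {ffun 'I_n -> option A}) :
  #|graph_of u| = #|vdom u|.
Proof.
rewrite -[vdom u]setIT -card_graph_of_dom; apply: eq_card => p.
by rewrite !inE andbT.
Qed.

(** * From compatible labels to a good assignment *)

(** A violated constraint has an endpoint outside [D]. By regularity at most [#|~: D| * d] of the
    [n * d] oriented constraints start outside [D], and as many end there, hence the factor 2. *)
Lemma OPT_ge_consistent (R : realType) (n : nat) (A : finType) (psi : csp2 n A)
    (d : nat) (D : {set 'I_n}) (sigma : {ffun 'I_n -> A}) :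
  (0 < d)%N -> (0 < n)%N -> csp2_wf psi -> csp2_regular psi d ->
  (forall v w, v \in D -> w \in D -> cadj psi v w ->
     cons psi v w (sigma v) (sigma w)) ->
  1 - 2 * #|~: D|%:R / n%:R <= OPT R psi.
Proof.
move=> d0 n0 [sym _ _] reg HD.
apply: (@le_trans _ _ (csp2_val R psi sigma)); last exact: le_bigmax.
have sumE (X : {set 'I_n}) :
    #|[set p : 'I_n * 'I_n | (p.1 \in X) && cadj psi p.1 p.2]| = (#|X| * d)%N.
  rewrite -sum1dep_card.
  rewrite -(@pair_big_dep _ _ _ _ _ (mem X) (fun i j => cadj psi i j) (fun _ _ => 1%N)) /=.
  rewrite -sum_nat_const; apply: eq_bigr => i _; rewrite sum1dep_card; exact: reg.
have E : #|[set p : 'I_n * 'I_n | cadj psi p.1 p.2]| = (n * d)%N.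
  have := sumE setT; rewrite cardsT card_ord => <-; apply: eq_card => p.
  by rewrite !inE.
rewrite /csp2_val E.
set Sat := [set p | _ && _].
have H : (n * d <= #|Sat| + 2 * (#|~: D| * d))%N.
  rewrite -E mul2n -addnn -{1}(sumE (~: D)).
  have -> : (#|~: D| * d)%N = #|[set p : 'I_n * 'I_n | (p.2 \in ~: D) && cadj psi p.1 p.2]|.
    have inj : injective (fun p : 'I_n * 'I_n => (p.2, p.1)) by move=> [a b] [? ?] [-> ->].
    rewrite -sumE -(card_imset _ inj) /=.
    apply: eq_card => -[i j]; apply/imsetP/idP => [[[a b]]|].
      by rewrite !inE /= => ? [-> ->]; rewrite sym.
    by rewrite !inE /= => H; exists (j, i); rewrite // !inE /= sym.
  set X := [set p | _ && _]; set Y := [set p | _ && _].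
  apply: (@leq_trans #|Sat :|: (X :|: Y)|); last first.
    by apply: leq_trans (leq_card_setU _ _) _; rewrite leq_add2l leq_card_setU.
  apply: subset_leq_card; apply/subsetP => -[i j]; rewrite !inE /= => a.
  rewrite a !andbT /=; case iD: (i \in D); case jD: (j \in D); rewrite ?orbT //=.
  by rewrite HD.
have nd0 : 0 < (n * d)%:R :> R by rewrite ltr0n muln_gt0 n0.
rewrite ler_pdivlMr // natrM mulrA mulrBl mul1r divfK ?gt_eqF ?ltr0n //.
rewrite mulrBl lerBlDr; move: H; rewrite -(ler_nat R) natrD !natrM; lra.
Qed.

(* The labels [a] at [v] that a vertex adjacent to every member of [I] may carry. *)
Definition compat (n : nat) (A : finType) (psi : csp2 n A)
    (I : {set {ffun 'I_n -> option A}}) (v : 'I_n) (a : A) : bool :=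
  [forall c in I, [forall b, (c v == Some b) ==> (a == b)] &&
    [forall j, [forall b, cadj psi v j && (c j == Some b) ==> cons psi v j a b]]].

Lemma compatP (n : nat) (A : finType) (psi : csp2 n A)
    (I : {set {ffun 'I_n -> option A}}) (v : 'I_n) (a : A) :
  reflect (forall c, c \in I -> (forall b, c v = Some b -> a = b) /\
     (forall j b, cadj psi v j -> c j = Some b -> cons psi v j a b))
    (compat psi I v a).
Proof.
apply: (iffP forall_inP) => H c cI.
  have /andP[/forallP H1 /forallP H2] := H c cI; split=> [b cv|j b vj cj].
    by have := H1 b; rewrite cv eqxx => /eqP.
  by have /forallP/(_ b) := H2 j; rewrite vj cj eqxx.
have [H1 H2] := H c cI; apply/andP; split.
  by apply/forallP=> b; apply/implyP=> /eqP/H1/eqP.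
by apply/forallP=> j; apply/forallP=> b; apply/implyP=> /andP[vj /eqP]; exact: H2.
Qed.

Lemma Gedge_compat (n : nat) (A : finType) (psi : csp2 n A)
    (I : {set {ffun 'I_n -> option A}}) (u : {ffun 'I_n -> option A}) v a :
  (forall c, c \in I -> Gedge psi u c) -> u v = Some a -> compat psi I v a.
Proof.
move=> H uv; apply/compatP => c /H /and4P[_ _ /forallP H1 /forallP H2]; split.
  by move=> b cv; have /forallP/(_ a)/forallP/(_ b) := H1 v; rewrite uv cv !eqxx => /eqP.
move=> j b vj cj; have /forallP/(_ j)/forallP/(_ a)/forallP/(_ b) := H2 v.
by rewrite vj uv cj !eqxx.
Qed.

(** On these variables the compatible label is unique: a member of [I] that assigns [v] forces
    it. *)
Definition decided (n : nat) (A : finType) (psi : csp2 n A)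
    (I : {set {ffun 'I_n -> option A}}) : {set 'I_n} :=
  [set v in \bigcup_(c in I) vdom c | [exists a, compat psi I v a]].

Lemma mem_bigcup_vdom (n : nat) (A : finType) (I : {set {ffun 'I_n -> option A}}) v :
  v \in \bigcup_(c in I) vdom c -> exists c b, c \in I /\ c v = Some b.
Proof.
move=> /bigcupP[c cI]; rewrite inE; case cv : (c v) => [b|] // _.
by exists c, b.
Qed.

(** For decided [v] and [w], some [c] in [I] assigns [w], and the label at [w] must equal that of
    [c]; compatibility of the label at [v] with [c] then satisfies the constraint between them. *)
Lemma OPT_ge_decided (R : realType) (n : nat) (A : finType) (psi : csp2 n A)
    (d : nat) (I : {set {ffun 'I_n -> option A}}) (a0 : A) :
  (0 < d)%N -> (0 < n)%N -> csp2_wf psi -> csp2_regular psi d ->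
  1 - 2 * #|~: decided psi I|%:R / n%:R <= OPT R psi.
Proof.
move=> d0 n0 wf reg.
(* The default [a0] is taken only where no label is compatible. *)
pose sigma := [ffun v => odflt a0 [pick a | compat psi I v a]].
have sigmaP v : v \in decided psi I -> compat psi I v (sigma v).
  rewrite inE ffunE => /andP[_ /existsP[a ca]].
  by case: pickP => [//|/(_ a)]; rewrite ca.
apply: (@OPT_ge_consistent _ _ _ _ d _ sigma) => // v w vD wD vw.
have /compatP cv := sigmaP v vD; have /compatP cw := sigmaP w wD.
move: wD; rewrite inE => /andP[/mem_bigcup_vdom[c [b [cI cwb]]] _].
by rewrite (proj1 (cw c cI) b cwb); exact: (proj2 (cv c cI)).
Qed.

(** Checked variable by variable: the weight is at most 1/2 off [U], at most [#|A|] on the part of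
    [U] not covered by [I], at most 1 on decided variables, and 0 on covered undecided ones. *)
Lemma sum_compat_le (R : realType) (n : nat) (A : finType) (psi : csp2 n A)
    (I : {set {ffun 'I_n -> option A}}) (U : {set 'I_n}) (a0 : A) :
  \bigcup_(c in I) vdom c \subset U ->
  \sum_(p : 'I_n * A) (compat psi I p.1 p.2)%:R *
      (if p.1 \in U then 1 else (2 * #|A|%:R)^-1)
    <= n%:R - #|~: decided psi I|%:R / 2
       + #|A|%:R * #|U :\: \bigcup_(c in I) vdom c|%:R :> R.
Proof.
move=> IU; set UI := \bigcup_(c in I) _ in IU *.
have A0 : 0 < #|A|%:R :> R by rewrite ltr0n; apply/card_gt0P; exists a0.
rewrite -(@pair_big _ _ _ _ _ predT predT (fun v a => (compat psi I v a)%:R *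
      (if v \in U then 1 else (2 * #|A|%:R)^-1))) /=.
have cE (X : {set 'I_n}) : #|X|%:R = \sum_v (v \in X)%:R :> R.
  by rewrite -sum1_card natr_sum big_mkcond /=; apply: eq_bigr => v _; case: (v \in X).
have -> : n%:R = \sum_(v : 'I_n) 1 :> R by rewrite sumr_const card_ord.
rewrite !cE mulr_suml mulr_sumr -sumrB -big_split /=; apply: ler_sum => v _.
have sA (c : R) : 0 <= c -> \sum_a (compat psi I v a)%:R * c <= #|A|%:R * c.
  move=> c0; rewrite -mulr_suml; apply: ler_wpM2r => //.
  rewrite -sum1_card natr_sum; apply: ler_sum => a _.
  by rewrite ler_nat; case: (compat _ _ _ _).
rewrite [in leRHS]inE [v \in U :\: _]inE.
have [vU|vU] := boolP (v \in U); last first.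
  have vUI : v \notin UI by apply: contra vU; exact: (subsetP IU).
  have -> : v \in decided psi I = false by rewrite inE (negbTE vUI).
  apply: le_trans (sA _ _) _; first by rewrite invr_ge0 mulr_ge0 // ltW.
  rewrite vUI /= mulr0 addr0 invfM mulrCA divff ?gt_eqF //; lra.
have [vUI|vUI] := boolP (v \in UI); last first.
  apply: le_trans (sA _ _) _ => //.
  rewrite /= !mulr1; case: (_ \notin _) => /=; lra.
rewrite /= mulr0 addr0; have [vD|vD] := boolP (v \in decided psi I).
  have [c [b [cI cvb]]] := mem_bigcup_vdom vUI.
  rewrite mul0r subr0 (bigD1 b) //= big1 ?addr0 => [|a ab].
    by rewrite mulr1 lern1 leq_b1.
  case: compatP => [/(_ c cI)[/(_ b cvb) ab' _]|_]; last by rewrite mul0r.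
  by rewrite ab' eqxx in ab.
rewrite big1 => [|a _]; first by rewrite /=; lra.
case ca: (compat _ _ _ _); rewrite ?mul0r //.
suff : v \in decided psi I by rewrite (negbTE vD).
by rewrite inE vUI; apply/existsP; exists a.
Qed.

(** Condenses the combinatorics into numerical inequalities, with [m = #|C|], [g = #|C :\: I|] and
    [W] the total weight of compatible labels. *)
Lemma dense_subset_count (R : realType) (n : nat) (A : finType) (psi : csp2 n A)
    (d q t rho : nat) (S : {set {ffun 'I_n -> option A}}) (a0 : A) :
  (0 < d)%N -> (0 < n)%N -> csp2_wf psi -> csp2_regular psi d ->
  (0 < q)%N -> S \subset Vset n A rho -> S != set0 ->
  (8 * q ^ 2 * #|[set p in setX S S | ~~ Gedge psi p.1 p.2]| <= #|S| ^ 2)%N ->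
  exists (m g : nat) (W : R),
    [/\ (m * t.+1 <= n)%N, (q * g <= m)%N, 0 <= W,
        #|S|%:R * (2 * #|A|%:R) ^- t * (rho`!)%:R <= 4 * 2 ^+ m * W ^+ rho &
        1 - 4 * (n%:R - W) / n%:R - 4 * (#|A| * (g * rho))%:R / n%:R <= OPT R psi].
Proof.
move=> d0 n0 wf reg q0 SV S0 HN.
(* The covering threshold [t.+1] leaves each vertex of [S1] at most [t] variables outside [U]. *)
have [C [I [S1 [[IC CS S1S] [Ct qI S4 S1e S1t]]]]] :=
  @dense_set_fiber _ _ (Gedge psi) S (@vdom n A) q t.+1 q0 isT S0 HN.
set U := \bigcup_(c in C) _ in Ct S1t.
have IU : \bigcup_(c in I) vdom c \subset U.
  by apply/bigcupsP => c cI; apply: bigcup_sup; exact: (subsetP IC).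
have A0 : 0 < #|A|%:R :> R by rewrite ltr0n; apply/card_gt0P; exists a0.
have A1 : 1 <= #|A|%:R :> R by rewrite ler1n; apply/card_gt0P; exists a0.
set h : R := (2 * #|A|%:R)^-1.
have h0 : 0 < h by rewrite invr_gt0 mulr_gt0.
have h1 : h <= 1 by rewrite invf_le1 ?mulr_gt0 //; lra.
pose f (p : 'I_n * A) : R := (compat psi I p.1 p.2)%:R * (if p.1 \in U then 1 else h).
have f0 p : 0 <= f p by rewrite mulr_ge0 //; case: ifP => // _; exact: ltW.
have cardV u : u \in Vset n A rho -> #|vdom u| = rho by rewrite inE => /eqP.
exists #|C|, #|C :\: I|, (\sum_p f p); split=> //.
- by apply: leq_trans Ct _; rewrite -[leqRHS](card_ord n) max_card.
- by apply: sumr_ge0.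
- have H : #|[set graph_of u | u in S1]|%:R * h ^+ t * (rho`!)%:R <= (\sum_p f p) ^+ rho.
    apply: weighted_card_le => // P /imsetP[u uS1 ->]; split.
      by rewrite card_graph_of; apply: cardV; apply: (subsetP SV); apply: (subsetP S1S).
    (* All labels used by [u] are compatible with [I], so only its variables outside [U] contribute
       a factor other than 1. *)
    rewrite (eq_bigr (fun p : 'I_n * A => if p.1 \in ~: U then h else 1)); last first.
      move=> [v a]; rewrite !inE /f /= => /eqP uv.
      rewrite (Gedge_compat (u := u)) ?mul1r; first by case: (v \in U).
        by move=> c; exact: S1e.
      by [].
    rewrite -big_mkcondr /= prodr_const.
    have -> : #|[pred p in graph_of u | p.1 \in ~: U]| = #|vdom u :\: U|.
      by rewrite setDE -card_graph_of_dom; apply: eq_card => p; rewrite !inE.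
    have /(_ u uS1) := S1t; rewrite ltnS => le_t.
    by rewrite ler_wiXn2l // ltW.
  rewrite card_imset in H; last exact: graph_of_inj.
  have S4R : #|S|%:R <= 4 * (2 ^+ #|C| * #|S1|%:R) :> R.
    by rewrite -[2 ^+ _]natrX -!natrM ler_nat.
  rewrite -exprVn -/h.
  apply: (@le_trans _ _ (4 * (2 ^+ #|C| * #|S1|%:R) * h ^+ t * (rho`!)%:R)).
    by rewrite !ler_wpM2r // exprn_ge0 // ltW.
  rewrite -!mulrA; apply: ler_wpM2l => //; apply: ler_wpM2l; first exact: exprn_ge0.
  by rewrite mulrA.
apply: le_trans (@OPT_ge_decided R _ _ _ d I a0 d0 n0 wf reg).
have n0R : 0 < n%:R :> R by rewrite ltr0n.
have HW : \sum_p f p <= _ := sum_compat_le R psi a0 IU.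
(* Variables lost in passing from [C] to [I] lie in the domains of the [g] discarded members, each
   of size [rho]. *)
have gle : #|U :\: \bigcup_(c in I) vdom c|%:R <= (#|C :\: I| * rho)%:R :> R.
  rewrite ler_nat; apply: (@leq_trans #|\bigcup_(c in C :\: I) vdom c|).
    apply: subset_leq_card; apply/subsetP => v; rewrite inE => /andP[vI /bigcupP[c cC cv]].
    apply/bigcupP; exists c => //; rewrite inE cC andbT.
    by apply: contra vI => cI; apply/bigcupP; exists c.
  apply: leq_trans (_ : \sum_(c in C :\: I) #|vdom c| <= _)%N.
    elim/big_rec2: _ => [|c x y _ IH]; first by rewrite cards0.
    by apply: leq_trans (leq_card_setU _ _) _; rewrite leq_add2l.
  rewrite -sum_nat_const; apply: leq_sum => c; rewrite inE => /andP[_ cC].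
  by rewrite (cardV c) //; apply: (subsetP SV); apply: (subsetP CS).
rewrite -addrA -opprD lerB // -mulrDl ler_pM2r ?invr_gt0 //.
move: (ler_wpM2l (ltW A0) gle) HW; rewrite (natrM _ #|A|); set x := _ * _; set y := _ * _.
set w := \sum_p f p; lra.
Qed.

(** * Growth of [rho] and size of the vertex set *)

Lemma ln2_bounds (R : realType) : 1 / 2 <= ln (2 : R) <= 1.
Proof.
apply/andP; split.
  rewrite -[leLHS]expRK ler_ln ?posrE ?expR_gt0 //.
  have := expR_ge1Dx (- (1 / 2) : R); rewrite expRN -[leRHS]div1r ler_pdivlMr ?expR_gt0 //; lra.
rewrite -[leRHS]expRK ler_ln ?posrE ?expR_gt0 //.
by have := expR_ge1Dx (1 : R).
Qed.

Lemma ln_le_self (R : realType) (x : R) : 0 < x -> ln x <= x.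
Proof.
move=> x0; have := @le_ln1Dx R (x - 1); rewrite (_ : 1 + (x - 1) = x) => [H|]; last by ring.
by apply: le_trans (H _) _; lra.
Qed.

Lemma nat_ge_exists (R : archiRealDomainType) (x : R) :
  exists N : nat, forall n : nat, (N <= n)%N -> x <= n%:R.
Proof.
exists (Num.truncn x).+1 => n Nn; apply: ltW; apply: lt_le_trans (truncnS_gt x) _.
by rewrite ler_nat.
Qed.

(** The first bound holds because [log log n] is unbounded, the second because it is at most 16
    times the fourth root of [n]. *)
Lemma rho_of_asymptotics (R : realType) (M : R) : 1 <= M ->
  exists N : nat, forall n : nat, (N <= n)%N ->
    M * n%:R <= (rho_of R n)%:R ^+ 2 /\ M * (rho_of R n)%:R <= n%:R :> R.
Proof.
move=> M1; have /andP[l2a l2b] := ln2_bounds R.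
have l20 : 0 < ln 2 :> R by lra.
(* This is 2 to the power [2 ^ (M + 1)], so [n >= K] gives [log log n >= M + 1]; the extra 1 absorbs
   the truncation in [rho_of]. *)
pose K : R := expR (ln 2 * expR (ln 2 * (M + 1))).
have [N1 HN1] := nat_ge_exists K.
have [N2 HN2] := nat_ge_exists ((16 * M) ^+ 4).
exists (maxn 1 (maxn N1 N2)) => n; rewrite !geq_max => /and3P[n1 /HN1 nK /HN2 nM].
have n0 : 0 < n%:R :> R by rewrite ltr0n.
set sn := Num.sqrt (n%:R : R); set L := log2 (log2 (n%:R : R)).
have sn1 : 1 <= sn by rewrite -[1]sqrtr1 ler_sqrt // ler1n.
have sn2 : sn ^+ 2 = n%:R by rewrite sqr_sqrtr // ltW.
have l2n : expR (ln 2 * (M + 1)) <= log2 (n%:R : R).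
  by rewrite /log2 ler_pdivlMr // mulrC -[leLHS]expRK ler_ln ?posrE ?expR_gt0.
have l2n0 : 0 < log2 (n%:R : R) by apply: lt_le_trans l2n; exact: expR_gt0.
have LM : M + 1 <= L.
  by rewrite /L {1}/log2 ler_pdivlMr // mulrC -[leLHS]expRK ler_ln ?posrE ?expR_gt0.
have snL : 0 <= sn * L by apply: mulr_ge0; lra.
have /andP[r1 r2] := truncn_itv snL; rewrite -/(rho_of R n) -natr1 in r1 r2.
set r : R := (rho_of R n)%:R in r1 r2 *.
split.
  have Mr : M * sn <= r.
    have := @ler_wpM2l R sn _ _ _ LM; rewrite mulrDr; lra.
  apply: (@le_trans _ _ ((M * sn) ^+ 2)).
    rewrite exprMn sn2; apply: ler_wpM2r; first exact: ltW.
    by rewrite expr2 ler_peMl //; lra.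
  by rewrite ler_pXn2r ?nnegrE ?ler0n // mulr_ge0; lra.
pose s := Num.sqrt sn.
have s0 : 0 < s by rewrite sqrtr_gt0; lra.
have s2 : s ^+ 2 = sn by rewrite sqr_sqrtr //; lra.
have s4 : s ^+ 4 = n%:R by rewrite -sn2 -s2 -exprM.
have Ms : 16 * M <= s.
  by rewrite -(@ler_pXn2r R 4) ?nnegrE ?s4 //; lra.
have l2s : log2 (n%:R : R) <= 8 * s.
  rewrite /log2 ler_pdivrMr // -s4 lnXn //.
  have := ln_le_self s0; have := ler_wpM2l (ltW s0) l2a; rewrite -mulr_natr; lra.
have Ls : L <= 16 * s.
  rewrite /L {1}/log2 ler_pdivrMr //.
  apply: le_trans (ln_le_self l2n0) _; apply: le_trans l2s _.
  have := ler_wpM2l (ltW s0) l2a; lra.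
have rs : r <= 16 * s ^+ 3.
  apply: le_trans r1 _; rewrite (_ : 16 * s ^+ 3 = sn * (16 * s)); last by rewrite -s2; ring.
  by apply: ler_wpM2l => //; lra.
have M0 : 0 <= M by lra.
apply: le_trans (ler_wpM2l M0 rs) _; rewrite -s4.
rewrite (_ : M * (16 * _) = s ^+ 3 * (16 * M)); last by ring.
by rewrite [leRHS]exprSr; apply: ler_wpM2l => //; apply: exprn_ge0; exact: ltW.
Qed.

Lemma card_Vset_le (n : nat) (A : finType) (r : nat) :
  (#|Vset n A r| <= (n * #|A|) ^ r)%N.
Proof.
have := @weighted_card_le rat _ (fun _ : 'I_n * A => 1) r [set graph_of u | u in Vset n A r] 1.
rewrite card_imset; last exact: graph_of_inj.
rewrite mulr1 sumr_const card_prod card_ord -natrX -natrM ler_nat => H.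
apply: leq_trans (leq_pmulr _ (fact_gt0 r)) (H _ _) => // P /imsetP[u].
by rewrite inE => /eqP ur ->; rewrite card_graph_of ur big1.
Qed.

Lemma card_Vset_ge (n : nat) (A : finType) (r : nat) (a : A) :
  ('C(n, r) <= #|Vset n A r|)%N.
Proof.
rewrite -[n in 'C(n, _)]card_ord -card_draws.
pose F (T : {set 'I_n}) := [ffun i => if i \in T then Some a else None].
have FK : cancel F (@vdom n A).
  by move=> T; apply/setP=> i; rewrite inE ffunE; case: (i \in T).
rewrite -(card_imset _ (can_inj FK)); apply: subset_leq_card.
by apply/subsetP=> _ /imsetP[T Tr ->]; rewrite inE FK; rewrite inE in Tr.
Qed.

Lemma exp2_le_bin (n r : nat) : (2 * r <= n)%N -> (2 ^ r <= 'C(n, r))%N.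
Proof.
elim: r n => [|r IH] [|n] H; rewrite ?bin0 //.
have /IH IHn : (2 * r <= n)%N by lia.
have := mul_bin_diag n.+1 r; rewrite /= => E.
rewrite -(leq_pmul2l (ltn0Sn r)) -E expnS mulnCA mulnA.
by apply: leq_mul => //; lia.
Qed.

(** With [v = #|V|], the bound [v <= n ^ (2 r)] gives [ln v <= 2 r ln n], while
    [log2 v >= r >= sqrt n] gives [log log v >= (ln n) / 2]. The quotient is at most [4 r]. *)
Lemma subset_threshold_ge (R : realType) (n : nat) (A : finType) (a : A) (r : nat) (eps : R) :
  0 <= eps -> (1 < n)%N -> (2 * r <= n)%N -> (n <= r ^ 2)%N -> (#|A| <= n)%N ->
  expR (- (4 * eps * r%:R)) <=
    powR (#|Vset n A r|%:R : R) (- eps / log2 (log2 (#|Vset n A r|%:R))).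
Proof.
move=> e0 n1 rn nr An; set v : R := #|Vset n A r|%:R.
have /andP[l2a l2b] := ln2_bounds R.
have l20 : 0 < ln 2 :> R by lra.
have n0 : 0 < n%:R :> R by rewrite ltr0n; lia.
have r0 : 0 < r%:R :> R by rewrite ltr0n; case: (r) nr => [|//]; lia.
have A0 : 0 < #|A|%:R :> R by rewrite ltr0n; apply/card_gt0P; exists a.
have v2 : 2 ^+ r <= v.
  by rewrite -natrX ler_nat; apply: leq_trans (exp2_le_bin rn) (card_Vset_ge n r a).
have v0 : 0 < v by apply: lt_le_trans v2; exact: exprn_gt0.
have lnn : 0 < ln n%:R :> R by rewrite ln_gt0 // ltr1n.
have lvr : r%:R <= log2 v.
  rewrite /log2 ler_pdivlMr // mulr_natl -lnXn // ler_ln ?posrE //.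
  exact: exprn_gt0.
have L1 : ln n%:R / 2 <= log2 (log2 v).
  have H : ln n%:R <= 2 * ln (log2 v).
    have -> : 2 * ln (log2 v) = ln (log2 v ^+ 2).
      by rewrite lnXn ?mulr_natl //; apply: lt_le_trans lvr.
    rewrite ler_ln ?posrE //; last by apply: exprn_gt0; apply: lt_le_trans lvr.
    apply: (@le_trans _ _ (r%:R ^+ 2)); first by rewrite -natrX ler_nat.
    by rewrite ler_pXn2r ?nnegrE // ltW //; apply: lt_le_trans lvr.
  rewrite /log2 -/(log2 v) ler_pdivlMr //.
  have := ler_wpM2l (ltW lnn) l2b; lra.
have L0 : 0 < log2 (log2 v) by lra.
have lv : ln v <= 2 * r%:R * ln n%:R.
  have H : v <= (n%:R ^+ 2) ^+ r.
    apply: (@le_trans _ _ ((n * #|A|) ^ r)%:R); first by rewrite ler_nat card_Vset_le.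
    by rewrite -!natrX ler_nat leq_exp2r -?(ltr0n R) // -mulnn leq_mul2l An orbT.
  apply: le_trans (_ : ln ((n%:R ^+ 2) ^+ r) <= _).
    by rewrite ler_ln ?posrE // exprn_gt0 // exprn_gt0.
  by rewrite !lnXn ?exprn_gt0 // -[_ *+ r]mulr_natr -[_ *+ 2]mulr_natr; lra.
rewrite /powR gt_eqF // ler_expR mulNr mulNr lerN2 mulrAC ler_pdivrMr //.
have := ler_wpM2l e0 lv.
have := ler_wpM2l (mulr_ge0 e0 (ltW r0)) L1; lra.
Qed.

(** * Total weight close to [n] *)

Lemma exp_sub_le_ffact (n r : nat) : ((n - r) ^ r <= n ^_ r)%N.
Proof.
elim: r => // k IH; rewrite ffactnSr expnSr.
apply: leq_mul; last by rewrite leq_sub2l.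
apply: leq_trans IH; case: k => // k; rewrite leq_exp2r // leq_sub2l //.
Qed.

(** If [W < (1 - zeta) n], then [W ^ r] loses a factor [exp (- zeta r)] against [n ^ r]. The other
    factors recover at most [exp (5 zeta r / 6)]: one sixth each for [r! 'C(n, r)] against [n ^ r],
    for [s] against ['C(n, r)] and for [(2 a) ^- t], and two sixths for [4 * 2 ^+ m]. *)
Lemma weight_lower_bound (R : realType) (zeta s W : R) (n r t m a : nat) :
  0 < zeta -> zeta <= 1 -> 12 <= zeta * r%:R -> 12 * r%:R <= zeta * n%:R ->
  6 * m%:R <= zeta * r%:R -> 12 * a%:R * t%:R <= zeta * r%:R ->
  (0 < a)%N -> 0 <= W ->
  'C(n, r)%:R * expR (- (zeta / 6 * r%:R)) <= s ->
  s * (2 * a%:R) ^- t * (r`!)%:R <= 4 * 2 ^+ m * W ^+ r ->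
  (1 - zeta) * n%:R <= W.
Proof.
move=> z0 z1 zr rn zm zt a0 W0 ks sW; rewrite leNgt; apply/negP => Wlt.
have r0 : 0 < r%:R :> R.
  by rewrite -(pmulr_rgt0 _ z0); lra.
have n0 : 0 < n%:R :> R by rewrite -(pmulr_rgt0 _ z0); lra.
have a0R : 0 < 2 * a%:R :> R by rewrite mulr_gt0 ?ltr0n.
have rlen : (r <= n)%N.
  by rewrite -(ler_nat R) -(ler_pM2l z0); have := ler_wpM2l (ltW r0) z1; lra.
set y := zeta / 6.
have eXr (x : R) : expR x ^+ r = expR (r%:R * x) by rewrite expRM_natl.
have kn : (n%:R * expR (- y)) ^+ r <= ('C(n, r) * r`!)%:R :> R.
  apply: (@le_trans _ _ ((n - r)%:R ^+ r)).
    rewrite lerXn2r ?nnegrE ?mulr_ge0 ?expR_ge0 // natrB // expRN ler_pdivrMr ?expR_gt0 //.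
    have ey : 1 + y <= expR y by exact: expR_ge1Dx.
    have nr0 : 0 <= n%:R - r%:R :> R by rewrite subr_ge0 ler_nat.
    apply: le_trans (ler_wpM2l nr0 ey).
    have y0 : 0 < y by rewrite /y divr_gt0.
    have : 2 * r%:R <= y * n%:R by rewrite /y; lra.
    have : y * r%:R <= 1 * (r%:R) by apply: ler_wpM2r; rewrite ?ltW // /y; lra.
    have := r0; lra.
  by rewrite bin_ffact -natrX ler_nat exp_sub_le_ffact.
have ht : expR (- (y * r%:R)) <= (2 * a%:R) ^- t.
  rewrite expRN lef_pV2 ?posrE ?exprn_gt0 ?expR_gt0 //.
  apply: (@le_trans _ _ (expR (2 * a%:R) ^+ t)).
    rewrite lerXn2r ?nnegrE ?expR_ge0 ?(ltW a0R) //.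
    by apply: le_trans (expR_ge1Dx _); lra.
  by rewrite -expRM_natl ler_expR /y; lra.
have e2 : 2 <= expR 1 :> R by exact: (expR_ge1Dx (1 : R)).
have hm : 4 * 2 ^+ m <= expR (2 * y * r%:R) :> R.
  apply: (@le_trans _ _ (expR 1 ^+ (2 + m))).
    rewrite exprD; apply: ler_pM; rewrite ?exprn_ge0 //.
      by rewrite expr2 (_ : 4 = 2 * 2 :> R) ?ler_pM //; ring.
    by rewrite lerXn2r ?nnegrE ?expR_ge0.
  by rewrite -expRM_natl mulr1 ler_expR natrD /y; lra.
have hW : W ^+ r <= (n%:R * expR (- zeta)) ^+ r.
  rewrite lerXn2r ?nnegrE ?mulr_ge0 ?expR_ge0 //.
  apply: le_trans (ltW Wlt) _; rewrite mulrC; apply: ler_wpM2l; first exact: ltW.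
  by have := expR_ge1Dx (- zeta).
have up : 4 * 2 ^+ m * W ^+ r <= n%:R ^+ r * expR (2 * y * r%:R - r%:R * zeta).
  rewrite expRD -mulrN -eXr mulrCA -exprMn; apply: ler_pM => //; last exact: exprn_ge0.
  by rewrite mulr_ge0 // exprn_ge0.
have dn : n%:R ^+ r * expR (- (3 * y * r%:R)) <= s * (2 * a%:R) ^- t * (r`!)%:R.
  apply: (@le_trans _ _ (('C(n, r) * r`!)%:R * expR (- (y * r%:R)) * expR (- (y * r%:R)))).
    rewrite (_ : - (3 * y * r%:R) = r%:R * - y + (- (y * r%:R)) + (- (y * r%:R))); last by ring.
    rewrite !expRD -eXr !mulrA -exprMn.
    by rewrite !ler_wpM2r ?expR_ge0.
  rewrite natrM (_ : 'C(n, r)%:R * _ * _ * _ =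
    'C(n, r)%:R * expR (- (y * r%:R)) * expR (- (y * r%:R)) * (r`!)%:R); last by ring.
  apply: ler_wpM2r => //; apply: ler_pM => //; rewrite ?mulr_ge0 ?expR_ge0 //.
have := le_trans dn (le_trans sW up); rewrite ler_pM2l ?exprn_gt0 // ler_expR /y.
have : 0 < zeta * r%:R by apply: mulr_gt0.
lra.
Qed.

(** * Density, choice of constants and conclusion *)

Lemma card_nonedges_le (R : realType) (n : nat) (A : finType) (psi : csp2 n A)
    (S : {set {ffun 'I_n -> option A}}) (q : nat) :
  (0 < q)%N -> 1 - (8 * q%:R ^+ 2)^-1 <= den R psi S ->
  S != set0 /\
  (8 * q ^ 2 * #|[set p in setX S S | ~~ Gedge psi p.1 p.2]| <= #|S| ^ 2)%N.
Proof.
move=> q0; have q1 : 1 <= q%:R :> R by rewrite ler1n.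
have Q0 : 8 <= 8 * q%:R ^+ 2 :> R by rewrite ler_peMr // exprn_ege1.
have Qi : (8 * q%:R ^+ 2)^-1 <= 8^-1 :> R by rewrite lef_pV2 ?posrE //; lra.
rewrite /den => H.
(* Division by zero yields 0, so the empty set has density 0, below the assumed bound. *)
have S0 : S != set0.
  by apply/eqP => SE; move: H; rewrite SE cards0 expr0n /= invr0 mulr0; lra.
split=> //.
have s0 : 0 < #|S|%:R ^+ 2 :> R by rewrite exprn_gt0 // ltr0n card_gt0.
move: H; rewrite ler_pdivlMr // => H.
have E : (#|[set p in setX S S | Gedge psi p.1 p.2]|
    + #|[set p in setX S S | ~~ Gedge psi p.1 p.2]| = #|S| ^ 2)%N.
  rewrite -mulnn -cardsX -(cardsID [set p | Gedge psi p.1 p.2] (setX S S)).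
  by congr (_ + _)%N; apply: eq_card => p; rewrite !inE // andbC.
have ER := congr1 (fun k => k%:R : R) E; rewrite natrD natrX in ER.
rewrite -(ler_nat R) natrM natrM !natrX -ler_pdivlMl; last by lra.
by rewrite -ER in H *; lra.
Qed.

Theorem mainTheorem2 (R : realType) (A : finType) (d : nat) (eta : R) :
  0 < eta -> (0 < d)%N ->
  exists (eps0 delta : R) (N : nat), 0 < eps0 /\ 0 < delta /\
  forall (n : nat) (psi : csp2 n A),
    (N <= n)%N ->
    csp2_wf psi -> csp2_regular psi d ->
    OPT R psi < 1 - eta ->
    let rho := rho_of R n in
    let V := Vset n A rho in
    let k : R := 'C(n, rho)%:R in
    let nV : R := #|V|%:R in
    let k' : R := k * powR nV (- eps0 / log2 (log2 nV)) in
    forall S : {set {ffun 'I_n -> option A}},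
      S \subset V ->
      k' <= #|S|%:R < k' + 1 ->
      den R psi S < 1 - delta.
Proof.
move=> eta0 d0.
(* The deficit [e1] is split in two halves: [4 * zeta = e1 / 2] for the missing weight, the rest for
   the members of [C] outside [I]. The successor in [a] keeps it positive before [A] is known to be
   inhabited. *)
pose e1 := Num.min eta 1; pose zeta := e1 / 8; pose a : R := #|A|.+1%:R.
(* Then [t <= c r] implies [12 #|A| t <= zeta r]. *)
pose c := zeta / (12 * a).
have e10 : 0 < e1 by rewrite lt_min eta0 ltr01.
have e1eta : e1 <= eta by rewrite ge_min lexx.
have e11 : e1 <= 1 by rewrite ge_min lexx orbT.
have a1 : 1 <= a by rewrite ler1n.
have z0 : 0 < zeta by rewrite /zeta; lra.
have z1 : zeta <= 1 by rewrite /zeta; lra.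
have c0 : 0 < c by rewrite divr_gt0 //; lra.
have ce0 : 0 < c * e1 := mulr_gt0 c0 e10.
have zc0 : 0 < zeta * c := mulr_gt0 z0 c0.
have [q0 Hq] := nat_ge_exists (8 * a / (c * e1)).
pose q := q0.+1; have {Hq} Hq : 8 * a <= q%:R * (c * e1).
  by rewrite -ler_pdivrMr //; apply: Hq.
(* The first summand makes [zeta r >= 12] and [zeta n >= 12 r]; the second bounds [m <= n / (c r)]
   by [zeta r / 6]. *)
pose M := 12 / zeta + 6 / (zeta * c).
have M12 : 12 <= M * zeta.
  rewrite /M mulrDl divfK ?gt_eqF // lerDl.
  by apply: mulr_ge0; [apply: divr_ge0|]; rewrite // ltW.
have Mc : 6 <= M * (zeta * c).
  rewrite /M mulrDl divfK ?gt_eqF // lerDr.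
  by apply: mulr_ge0; [apply: divr_ge0|]; rewrite // ltW.
have M0 : 0 < M by rewrite -(pmulr_lgt0 _ z0); lra.
have M1 : 12 <= M.
  by apply: le_trans M12 _; rewrite ler_piMr // ltW.
have [N HN] : exists N : nat, forall n : nat, (N <= n)%N ->
    M * n%:R <= (rho_of R n)%:R ^+ 2 /\ M * (rho_of R n)%:R <= n%:R :> R.
  by apply: rho_of_asymptotics; lra.
(* The size threshold costs [exp (- 4 eps0 r)], which is the allowed [exp (- zeta r / 6)]. *)
exists (zeta / 24), (8 * q%:R ^+ 2)^-1, (maxn 2 (maxn #|A| N)); split; first by lra.
split; first by rewrite invr_gt0 mulr_gt0 ?exprn_gt0 ?ltr0n.
move=> n psi; rewrite !geq_max => /and3P[n2 An /HN [Mn Mr]] wf reg optlt.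
move=> rho V k nV k' S SV /andP[kS _].
rewrite ltNge; apply/negP => /card_nonedges_le -/(_ isT) [S0 HE].
rewrite {}/k' {}/nV {}/k {}/V in SV kS; rewrite -/rho in Mn Mr.
clearbody rho; set r : R := rho%:R in Mn Mr.
have n0' : (0 < n)%N := ltnW n2.
have n0 : 0 < n%:R :> R by rewrite ltr0n.
have r0 : 0 < r.
  rewrite lt0r ler0n andbT; apply/eqP => r0; move: Mn; rewrite r0 expr0n /=.
  by rewrite leNgt mulr_gt0.
have rM : M <= r.
  rewrite -(ler_pM2r r0) -expr2; apply: le_trans Mn; apply: le_trans Mr _.
  by rewrite ler_peMl // ?ltW //; lra.
have [u uS] := set0Pn _ S0.
(* Since [rho > 0], a vertex of [S] assigns some variable and thus provides a label. *)
have [a0] : exists a0 : A, true.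
  have : (0 < #|vdom u|)%N.
    by have := subsetP SV _ uS; rewrite inE => /eqP ->; rewrite -(ltr0n R).
  by case/card_gt0P=> i; rewrite inE; case: (u i) => // b _; exists b.
move=> _; have A0 : (0 < #|A|)%N by apply/card_gt0P; exists a0.
have Aa : #|A|%:R <= a by rewrite ler_nat.
have cr0 : 0 <= c * r by rewrite mulr_ge0 // ltW.
have /andP[t1 t2] := truncn_itv cr0; set t := Num.truncn _ in t1 t2.
have [m [g [W [mt qg W0 count opt]]]] :=
  @dense_subset_count R n A psi d q t rho S a0 d0 n0' wf reg isT SV S0 HE.
have mcr : m%:R * (c * r) <= n%:R.
  apply: (@le_trans _ _ (m * t.+1)%:R); last by rewrite ler_nat.
  by rewrite natrM; apply: ler_wpM2l => //; apply: ltW.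
have zm : 6 * m%:R <= zeta * r.
  rewrite -(ler_pM2r (mulr_gt0 c0 r0)).
  have : 6 * n%:R <= M * (zeta * c) * n%:R by apply: ler_wpM2r => //; apply: ltW.
  have := ler_wpM2l (ltW zc0) Mn; rewrite expr2; lra.
have caz : 12 * a * c = zeta by rewrite /c; field; lra.
have zt : 12 * #|A|%:R * t%:R <= zeta * r.
  rewrite -caz -mulrA [leRHS](_ : _ = 12 * (a * (c * r))); last by ring.
  by apply: ler_wpM2l => //; apply: ler_pM.
have zr : 12 <= zeta * r.
  by apply: le_trans M12 _; rewrite mulrC; apply: ler_wpM2l => //; apply: ltW.
have rn : 12 * r <= zeta * n%:R.
  have := ler_wpM2l (ltW z0) Mr; have := ler_wpM2r (ltW r0) M12; lra.
have HW : (1 - zeta) * n%:R <= W.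
  apply: (@weight_lower_bound R zeta #|S|%:R W n rho t m #|A|) => //.
  apply: le_trans kS; apply: ler_wpM2l; first exact: ler0n.
  rewrite (_ : zeta / 6 * _ = 4 * (zeta / 24) * rho%:R); last by field.
  apply: (subset_threshold_ge a0) => //; first by lra.
    by rewrite -(ler_nat R) natrM -/r; apply: le_trans Mr; apply: ler_wpM2r; lra.
  rewrite -(ler_nat R) natrX -/r; apply: le_trans Mn.
  by rewrite ler_peMl // ?ltW //; lra.
(* Combines [q g <= m] and [m c r <= n] with the choice [8 a <= q c e1]. *)
have gle : 4 * (#|A| * (g * rho))%:R <= e1 / 2 * n%:R :> R.
  rewrite !natrM -/r.
  have H1 : q%:R * g%:R <= m%:R :> R by rewrite -natrM ler_nat.
  have H2 : 8 * a * (g%:R * r) <= q%:R * (c * e1) * (g%:R * r).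
    by apply: ler_wpM2r => //; rewrite mulr_ge0 // ltW.
  have H3 : e1 * (q%:R * g%:R * (c * r)) <= e1 * n%:R.
    apply: ler_wpM2l; first exact: ltW.
    by apply: le_trans mcr; apply: ler_wpM2r.
  have : #|A|%:R * (g%:R * r) <= a * (g%:R * r).
    by apply: ler_wpM2r => //; rewrite mulr_ge0 // ltW.
  lra.
move: opt; apply/negP; rewrite -ltNge; apply: lt_le_trans optlt _.
rewrite -addrA -opprD lerB // -mulrDl ler_pdivrMr //.
have := ler_wpM2r (ltW n0) e1eta; rewrite /zeta in HW; lra.
Qed.
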